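(* Let $X$ be a real normed space and $Y$ a real Banach space. Let $\psi:X\times X\to[0,\infty)$ be a function such that $$\sum_{i=0}^{\infty}\frac{\psi(0,2^i x)}{2^i}<\infty\quad\text{and}\quad\lim_{n\to\infty}\frac{\psi(2^n x,2^n y)}{2^n}=0$$ for all $x,y\in X$. Suppose that a function $f:X\to Y$ satisfies the inequality $$\|D_f(x,y)\|\leq\psi(x,y)$$ for all $x,y\in X$, and $f(0)=0$. Then there exist a unique quartic function $Q:X\to Y$ and a unique additive function $A:X\to Y$ such that both $g=Q$ and $g=A$ satisfy $$g(2x+y)+g(2x-y)=4\bigl(g(x+y)+g(x-y)\bigr)-\frac{3}{7}\bigl(g(2y)-2g(y)\bigr)+2g(2x)-8g(x)$$ for all $x,y\in X$, and $$\|f(x)-Q(x)-A(x)\|\leq\frac{1}{48}\sum_{i=0}^{\infty}\left(\frac{\psi(0,2^i x)+\psi(0,-2^i x)}{2\times 16^i}+\frac{12\bigl(\psi(0,2^i x)+\psi(0,-2^i x)\bigr)}{2^i}\right)$$ for all $x\in X$.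
   Context: For a function $f:X\to Y$, define $D_f:X\times X\to Y$ by $$D_f(x,y)=7[f(2x+y)+f(2x-y)]-28[f(x+y)+f(x-y)]+3[f(2y)-2f(y)]-14[f(2x)-4f(x)].$$ A function $Q:X\to Y$ is called quartic if $Q(2x+y)+Q(2x-y)=4(Q(x+y)+Q(x-y))+24Q(x)-6Q(y)$ for all $x,y\in X$. A function $A:X\to Y$ is additive if $A(x+y)=A(x)+A(y)$ for all $x,y\in X$. *)

(* Defs.v *)
From HB Require Import structures.
From mathcomp Require Import all_boot all_order all_algebra.
From mathcomp Require Import all_classical all_reals all_analysis.

Set Implicit Arguments.
Unset Strict Implicit.
Unset Printing Implicit Defensive.

Import Order.TTheory GRing.Theory Num.Theory.
Import numFieldNormedType.Exports.

Local Open Scope ring_scope.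

Definition D (R : realType) (X Y : lmodType R) (f : X -> Y) (x y : X) : Y :=
  (7 : R) *: (f ((2 : R) *: x + y) + f ((2 : R) *: x - y))
  - (28 : R) *: (f (x + y) + f (x - y))
  + (3 : R) *: (f ((2 : R) *: y) - (2 : R) *: f y)
  - (14 : R) *: (f ((2 : R) *: x) - (4 : R) *: f x).

Definition quartic (R : realType) (X Y : lmodType R) (Q : X -> Y) : Prop :=
  forall x y : X,
    Q ((2 : R) *: x + y) + Q ((2 : R) *: x - y) =
    (4 : R) *: (Q (x + y) + Q (x - y)) + (24 : R) *: Q x - (6 : R) *: Q y.

(* Additivity only: no compatibility with real scalars is required. *)
Definition additive_fun (R : realType) (X Y : lmodType R) (A : X -> Y) : Prop :=
  forall x y : X, A (x + y) = A x + A y.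

Definition mixed_eq (R : realType) (X Y : lmodType R) (g : X -> Y) : Prop :=
  forall x y : X,
    g ((2 : R) *: x + y) + g ((2 : R) *: x - y) =
    (4 : R) *: (g (x + y) + g (x - y))
    - (3 / 7 : R) *: (g ((2 : R) *: y) - (2 : R) *: g y)
    + (2 : R) *: g ((2 : R) *: x) - (8 : R) *: g x.

(* Main.v *)
(** The even and odd parts h of f, which are (f(x) + s f(-x))/2 for s = 1 and
    s = -1, satisfy D_h(0,y) = 3 (h(2y) - c h(y)) with c = 9 + 7s, that is
    c = 16 and c = 2. Hyers' direct method makes c^-n h(2^n x) converge to a
    function G with D_G = 0 and G(2x) = c G(x); this G is quartic for c = 16
    and additive for c = 2. For uniqueness, the difference q + a of two
    solutions has q even and a odd, so the bound on q + a bounds q and a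
    separately; homogeneity of degree c >= 2 under doubling then turns the
    bound into the tail of a convergent series. *)

Require Import Defs.
From mathcomp Require Import all_boot all_order all_algebra.
From mathcomp Require Import ring lra.
From mathcomp Require Import all_classical all_reals all_analysis.

Set Implicit Arguments.
Unset Strict Implicit.
Unset Printing Implicit Defensive.

Import Order.TTheory GRing.Theory Num.Theory.
Import numFieldNormedType.Exports.

Local Open Scope classical_set_scope.
Local Open Scope ring_scope.

(** * Reflexive proofs of linear identities in a module *)

Inductive vexp (K : Type) :=
  | VVar of nat
  | VZero
  | VAdd of vexp K & vexp K
  | VOpp of vexp K
  | VScale of K & vexp K.
Arguments VVar {K}.
Arguments VZero {K}.

Fixpoint veval (K : nzRingType) (V : lmodType K) (env : seq V) (e : vexp K) :
    V :=
  match e with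
  | VVar i => nth 0 env i
  | VZero => 0
  | VAdd e1 e2 => veval env e1 + veval env e2
  | VOpp e1 => - veval env e1
  | VScale k e1 => k *: veval env e1
  end.

Fixpoint vcoef (K : nzRingType) (e : vexp K) (i : nat) : K :=
  match e with
  | VVar j => if j == i then 1 else 0
  | VZero => 0
  | VAdd e1 e2 => vcoef e1 i + vcoef e2 i
  | VOpp e1 => - vcoef e1 i
  | VScale k e1 => k * vcoef e1 i
  end.

(** Recursion on the number of atoms lets [/=] unfold this into a conjunction of scalar equations,
    one per atom. *)
Fixpoint same_coefs (K : nzRingType) (n : nat) (e1 e2 : vexp K) : Prop :=
  if n is m.+1 then vcoef e1 m = vcoef e2 m /\ same_coefs m e1 e2 else True.

Lemma veval_sum (K : nzRingType) (V : lmodType K) (env : seq V) (e : vexp K) :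
  veval env e = \sum_(i < size env) vcoef e i *: nth 0 env i.
Proof.
elim: e => [j||e1 IH1 e2 IH2|e1 IH1|k e1 IH1] /=.
- have [jn|nj] := ltnP j (size env).
    rewrite (bigD1 (Ordinal jn)) //= eqxx scale1r big1 ?addr0 // => i ij.
    by rewrite ifN ?scale0r // eq_sym.
  (* An index past the environment denotes the default 0 and matches no [i] of the sum. *)
  rewrite nth_default // big1 // => i _.
  by rewrite ifN ?scale0r // gtn_eqF // (leq_trans _ nj).
- by rewrite big1 // => i _; rewrite scale0r.
- by rewrite IH1 IH2 -big_split; apply: eq_bigr => i _; rewrite scalerDl.
- by rewrite IH1 -sumrN; apply: eq_bigr => i _; rewrite scaleNr.
- by rewrite IH1 scaler_sumr; apply: eq_bigr => i _; rewrite scalerA.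
Qed.

Lemma veval_eq (K : nzRingType) (V : lmodType K) (env : seq V) (e1 e2 : vexp K) :
  same_coefs (size env) e1 e2 -> veval env e1 = veval env e2.
Proof.
move=> H; rewrite !veval_sum; apply: eq_bigr => -[i /= lt_i] _; congr (_ *: _).
elim: (size env) lt_i H => // n IH; rewrite ltnS leq_eqVlt => /orP[/eqP ->|/IH h].
  by case.
by case=> _ /h.
Qed.

(* Atoms are compared up to unification, since the same vector may occur with
   different but convertible structure instances. *)
Ltac vmem x env :=
  match env with
  | nil => constr:(false)
  | ?y :: _ => let _ := match goal with _ => unify x y end in constr:(true)
  | _ :: ?t => vmem x t
  end.

Ltac vatoms env t :=
  lazymatch t with
  | 0%R => env
  | (?a + ?b)%R => let env := vatoms env a in vatoms env b
  | (- ?a)%R => vatoms env a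
  | (_ *: ?a)%R => vatoms env a
  | _ => lazymatch vmem t env with
         | true => env
         | false => constr:(t :: env)
         end
  end.

Ltac vindex x env :=
  match env with
  | ?y :: _ => let _ := match goal with _ => unify x y end in constr:(0%N)
  | _ :: ?t => let n := vindex x t in constr:(n.+1)
  end.

Ltac vreify K env t :=
  lazymatch t with
  | 0%R => constr:(@VZero K)
  | (?a + ?b)%R =>
      let a := vreify K env a in let b := vreify K env b in constr:(@VAdd K a b)
  | (- ?a)%R => let a := vreify K env a in constr:(@VOpp K a)
  | (?k *: ?a)%R => let a := vreify K env a in constr:(@VScale K k a)
  | _ => let n := vindex t env in constr:(@VVar K n)
  end.

(* Proves an equality of linear combinations in an [lmodType K] by comparing the
   coefficients of each atom with [field], whose side conditions remain. *)
Ltac lmod K :=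
  lazymatch goal with
  | |- @eq ?V ?u ?v =>
    let env := vatoms (@nil V) u in
    let env := vatoms env v in
    let e1 := vreify K env u in
    let e2 := vreify K env v in
    apply: (@veval_eq K _ env e1 e2); rewrite /=; repeat split; field
  end.

(** Uses a hypothesis with multiplier [k]; the remaining linear identity goes to [lmod], or to a
    further application with another hypothesis. *)
Lemma eq_lincomb (R : nzRingType) (V : lmodType R) (k : R) (a b u v : V) :
  a = b -> u - v = k *: (a - b) -> u = v.
Proof. by move=> ->; rewrite subrr scaler0 => /eqP; rewrite subr_eq0 => /eqP. Qed.

(** * Algebra of quartic functions, additive functions and solutions of D = 0 *)

Section Algebra.
Variables (R : realType) (X Y : lmodType R).
Implicit Types (g Q A : X -> Y).

Lemma quartic0 Q : quartic Q -> Q 0 = 0.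
Proof.
move=> qQ; have := qQ 0 0; rewrite scaler0 !addr0 subr0 => E.
by apply: (eq_lincomb (k := - 24^-1) E); lmod R.
Qed.

Lemma quarticN Q x : quartic Q -> Q (- x) = Q x.
Proof.
move=> qQ; have := qQ 0 x; rewrite scaler0 !add0r (quartic0 qQ) => E.
by apply: (eq_lincomb (k := - 3^-1) E); lmod R.
Qed.

Lemma quartic2 Q x : quartic Q -> Q (2 *: x) = 16 *: Q x.
Proof.
move=> qQ; have := qQ x 0; rewrite !addr0 !subr0 (quartic0 qQ) => E.
by apply: (eq_lincomb (k := 2^-1) E); lmod R.
Qed.

Lemma additive_fun0 A : additive_fun A -> A 0 = 0.
Proof.
move=> aA; have := aA 0 0; rewrite addr0 => E.
by apply: (eq_lincomb (k := - 1) E); lmod R.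
Qed.

Lemma additive_funN A x : additive_fun A -> A (- x) = - A x.
Proof.
move=> aA; have := aA x (- x); rewrite subrr (additive_fun0 aA) => E.
by apply: (eq_lincomb (k := - 1) E); lmod R.
Qed.

Lemma additive_fun2 A x : additive_fun A -> A (2 *: x) = 2 *: A x.
Proof. by move=> aA; rewrite !scaler_nat !mulr2n aA. Qed.

Lemma D_mixed_eq g : (forall x y, D g x y = 0) -> mixed_eq g.
Proof.
move=> Dg x y; have := Dg x y; rewrite /D => E.
by apply: (eq_lincomb (k := 7^-1) E); lmod R.
Qed.

(** Under the doubling rule the last two brackets of [D] become 3(16 - 2) Q y and 14(16 - 4) Q x,
    which are 7 times 6 Q y and 24 Q x. *)
Lemma D_quartic Q : (forall x y, D Q x y = 0) ->
  (forall x, Q (2 *: x) = 16 *: Q x) -> quartic Q.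
Proof.
move=> DQ Q2 x y; have := DQ x y; rewrite /D !Q2 => E.
by apply: (eq_lincomb (k := 7^-1) E); lmod R.
Qed.

(* The second difference T x y of A along y satisfies T (2x) (2y) = 2 T x y
   because A doubles, and T (2x) y = 4 T x y by the equation; both scalings
   together with T x (2y) = T (x+y) y + 2 T x y + T (x-y) y force T = 0. *)
Lemma D_additive A : (forall x y, D A x y = 0) ->
  (forall x, A (2 *: x) = 2 *: A x) -> (forall x, A (- x) = - A x) ->
  additive_fun A.
Proof.
move=> DA A2 AN.
pose T x y := A (x + y) + A (x - y) - 2 *: A x.
have T2l x y : T (2 *: x) y = 4 *: T x y.
  have := DA x y; rewrite /T /D !A2 => E.
  by apply: (eq_lincomb (k := 7^-1) E); lmod R.
have T22 x y : T (2 *: x) (2 *: y) = 2 *: T x y.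
  by rewrite /T -scalerDr -scalerBr !A2; lmod R.
have T2r x y : T x (2 *: y) = 2^-1 *: T x y.
  have E := T2l x (2 *: y); rewrite T22 in E.
  by apply: (eq_lincomb (k := - 4^-1) E); lmod R.
have Tshift x y : T (x + y) y + T (x - y) y = - (3 / 2) *: T x y.
  have : T x (2 *: y) = T (x + y) y + 2 *: T x y + T (x - y) y.
    rewrite /T addrK subrK (_ : x + 2 *: y = x + y + y); last by lmod R.
    by rewrite (_ : x - 2 *: y = x - y - y); lmod R.
  by rewrite T2r => E; apply: (eq_lincomb (k := - 1) E); lmod R.
have T0 x y : T x y = 0.
  have E1 := Tshift (2 *: x) (2 *: y).
  rewrite -scalerDr -scalerBr !T22 in E1.
  have E2 := Tshift (2 *: x + y) y; have E3 := Tshift (2 *: x - y) y.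
  have E4 := Tshift x y; have E5 := Tshift (2 *: x) y.
  rewrite addrK (_ : 2 *: x + y + y = 2 *: (x + y)) ?T2l in E2; last by lmod R.
  rewrite subrK (_ : 2 *: x - y - y = 2 *: (x - y)) ?T2l in E3; last by lmod R.
  rewrite !T2l in E5.
  (* The sum of [E2] and [E3] expresses 4 (T (x+y) y + T (x-y) y) + 8 T x y through T (2x+y) y + T
     (2x-y) y. By [E4] the left side is 2 T x y, by [E5] the right side is 9 T x y, so 7 T x y =
     0. *)
  apply: (eq_lincomb (k := - 7^-1) E2).
  apply: (eq_lincomb (k := - 7^-1) E3).
  apply: (eq_lincomb (k := 3 / 14) E5).
  apply: (eq_lincomb (k := 4 / 7) E4).
  by lmod R.
(* T = 0 is Jensen's equation; adding its copy with x and y exchanged cancels A (x - y) against A (y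
   - x) by oddness. *)
move=> x y; have := T0 x y; have := T0 y x; rewrite /T.
rewrite (addrC y x) -(opprB x y) AN => E1 E2.
apply: (eq_lincomb (k := 2^-1) E1); apply: (eq_lincomb (k := 2^-1) E2).
by lmod R.
Qed.

End Algebra.

(** * Even and odd parts, treated together through the sign [s] *)

Definition parity_part (R : realType) (X Y : lmodType R) (s : R) (f : X -> Y)
  (x : X) : Y := 2^-1 *: (f x + s *: f (- x)).

Lemma D_parity_part (R : realType) (X Y : lmodType R) (s : R) (f : X -> Y) x y :
  D (parity_part s f) x y = 2^-1 *: (D f x y + s *: D f (- x) (- y)).
Proof.
by rewrite /D /parity_part !scalerN -!opprD; lmod R.
Qed.

(** At x = 0 the first two brackets collapse to -21 (1 + s) h y, and the third adds 3 h (2y) - 6 h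
    y. *)
Lemma D0l (R : realType) (X Y : lmodType R) (s : R) (h : X -> Y) y :
  h 0 = 0 -> (forall x, h (- x) = s *: h x) ->
  D h 0 y = 3 *: (h (2 *: y) - (9 + 7 * s) *: h y).
Proof. by move=> h0 hs; rewrite /D scaler0 !add0r h0 hs; lmod R. Qed.

(** * Limits of rescaled functions, and vanishing of homogeneous functions with a summable bound *)

Section Hyers.
Variables (R : realType) (X : normedModType R) (Y : completeNormedModType R).

Lemma ler_div_exp (c a : R) i : 2 <= c -> 0 <= a -> a / c ^+ i <= a / 2 ^+ i.
Proof.
move=> c2 a0; have [c0 c_ge0] : 0 < c /\ 0 <= c by split; lra.
by rewrite ler_wpM2l // lef_pV2 ?posrE ?exprn_gt0 // lerXn2r // nnegrE; lra.
Qed.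

(** The approximants telescope with increments at most b (2^n x) / c^(n+1). Since c >= 2,
    summability against powers of 2 gives absolute convergence, and completeness of [Y] the
    limit. *)
Lemma hyers_direct_method (h : X -> Y) (c : R) (b : X -> R) : 2 <= c ->
  (forall x, `|h (2 *: x) - c *: h x| <= b x) ->
  (forall x, (\sum_(0 <= i <oo) (b (2 ^+ i *: x) / 2 ^+ i)%:E < +oo)%E) ->
  exists G : X -> Y, forall x,
    c ^- n *: h (2 ^+ n *: x) @[n --> \oo] --> G x /\
    (`|h x - G x|%:E <= \sum_(0 <= i <oo) (b (2 ^+ i *: x) / c ^+ i.+1)%:E)%E.
Proof.
move=> c2 hb bs; have [c0 c_ge0] : 0 < c /\ 0 <= c by split; lra.
have c_neq0 : c != 0 by rewrite gt_eqF.
have b0 x : 0 <= b x by exact: le_trans (hb x).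
pose u x n := c ^- n *: h (2 ^+ n *: x).
have ub x n : `|u x n.+1 - u x n| <= b (2 ^+ n *: x) / c ^+ n.+1.
  have -> : u x n.+1 - u x n
      = c ^- n.+1 *: (h (2 *: (2 ^+ n *: x)) - c *: h (2 ^+ n *: x)).
    rewrite /u (exprS 2) -(scalerA 2) (exprS c).
    by lmod R; rewrite ?expf_neq0 c_neq0.
  rewrite normrZ ger0_norm ?invr_ge0 ?exprn_ge0 // [leRHS]mulrC.
  by rewrite ler_wpM2l ?invr_ge0 ?exprn_ge0.
have ucvg x : cvgn (u x).
  have nt : cvgn [normed series (telescope (u x))].
    have bs0 i : 0 <= b (2 ^+ i *: x) / 2 ^+ i by rewrite divr_ge0 ?exprn_ge0.
    apply: (series_le_cvg _ bs0 _ (nnseries_is_cvg bs0 (bs x))) => n //=.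
    apply: (le_trans (ub x n)); apply: (le_trans (ler_div_exp n.+1 c2 (b0 _))).
    rewrite ler_wpM2l // lef_pV2 ?posrE ?exprn_gt0 // exprS.
    by rewrite ler_peMl ?exprn_ge0 //; lra.
  have := normed_cvg nt; rewrite telescopeK => cu.
  have -> : u x = (fun n => (u x n - u x 0%N) + u x 0%N).
    by apply/funext => n; rewrite subrK.
  by apply: is_cvgD => //; exact: is_cvg_cst.
exists (fun x => limn (u x)) => x; split; first exact: ucvg.
set S := (\sum_(0 <= i <oo) _)%E.
have uS n : (`|h x - u x n|%:E <= S)%E.
  apply: (@le_trans _ _ (\sum_(0 <= i < n) (b (2 ^+ i *: x) / c ^+ i.+1)%:E)%E).
    rewrite sumEFin lee_fin.
    have -> : h x - u x n = - \sum_(0 <= i < n) (u x i.+1 - u x i).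
      by rewrite telescope_sumr // opprB /u !expr0 invr1 !scale1r.
    rewrite normrN; apply: (le_trans (ler_norm_sum _ _ _)).
    by apply: ler_sum => i _; exact: ub.
  by apply: nneseries_lim_ge => i _ _; rewrite lee_fin divr_ge0 ?exprn_ge0.
(* An infinite [S] makes the bound trivial; a finite one lets the limit be taken among real
   numbers. *)
have [Sfin|] := boolP (S \is a fin_num); last first.
  have S0 : (0 <= S)%E by apply: le_trans (uS 0%N); rewrite lee_fin.
  by rewrite ge0_fin_numE // -leNgt leye_eq => /eqP ->; rewrite leey.
rewrite -(fineK Sfin) lee_fin.
have cl : `|h x - u x n| @[n --> \oo] --> `|h x - limn (u x)|.
  by apply: cvg_norm; apply: cvgB; [exact: cvg_cst | exact: ucvg].
apply: (ler_cvg_to cl (cvg_cst (fine S))).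
by apply: nearW => n; rewrite -lee_fin (fineK Sfin).
Qed.

Lemma scaling_eq0 (g : X -> Y) (c K : R) (b : X -> R) : 2 <= c ->
  (forall x, 0 <= b x) -> (forall x, g (2 *: x) = c *: g x) ->
  (forall x, (\sum_(0 <= i <oo) (b (2 ^+ i *: x) / 2 ^+ i)%:E < +oo)%E) ->
  (forall x,
     (`|g x|%:E <= K%:E * \sum_(0 <= i <oo) (b (2 ^+ i *: x) / 2 ^+ i)%:E)%E) ->
  forall x, g x = 0.
Proof.
move=> c2 b0 g2 bs gb x; have [c0 c_ge0] : 0 < c /\ 0 <= c by split; lra.
pose t i := (b (2 ^+ i *: x) / 2 ^+ i)%:E.
have t0 i : (0 <= t i)%E by rewrite lee_fin divr_ge0 ?exprn_ge0.
have gX n : g (2 ^+ n *: x) = c ^+ n *: g x.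
  elim: n => [|n IH]; first by rewrite expr0 !scale1r.
  by rewrite exprS -scalerA g2 IH scalerA -exprS.
(* At [2 ^+ n *: x] the bounding series is 2^n times the tail from n, while g is multiplied by c^n
   >= 2^n. *)
have gt n : (`|g x|%:E <= K%:E * \sum_(n <= i <oo) t i)%E.
  rewrite -nneseries_addn //.
  have -> : (\sum_(0 <= i <oo) t (i + n)%N
     = (2 ^- n)%:E * \sum_(0 <= i <oo) (b (2 ^+ i *: (2 ^+ n *: x)) / 2 ^+ i)%:E)%E.
    rewrite -nneseriesZl => [|i _]; last by rewrite lee_fin divr_ge0 ?exprn_ge0.
    apply: eq_eseriesr => i _; rewrite /t -EFinM; congr EFin.
    by rewrite scalerA -exprD exprD invfM; ring.
  rewrite muleCA.
  apply: (@le_trans _ _ ((2 ^- n)%:E * `|g (2 ^+ n *: x)|%:E)%E); last first.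
    by apply: lee_wpmul2l => //; rewrite lee_fin invr_ge0 exprn_ge0.
  rewrite -EFinM lee_fin gX normrZ ger0_norm ?exprn_ge0 //.
  rewrite mulrA ler_peMl // mulrC ler_pdivlMr ?exprn_gt0 // mul1r.
  by rewrite lerXn2r // nnegrE; lra.
apply/normr0_eq0/eqP; rewrite eq_le normr_ge0 andbT -lee_fin.
have tl := cvgeZl (y := K%:E) isT (nneseries_tail_cvg (bs x) (fun i _ => t0 i)).
rewrite mule0 in tl.
by apply: (lee_cvg_to (cvg_cst `|g x|%:E) tl); apply: nearW => n; exact: gt.
Qed.

Lemma stable_part (s : R) (h : X -> Y) (phi : X -> X -> R) :
  2 <= 9 + 7 * s -> h 0 = 0 -> (forall x, h (- x) = s *: h x) ->
  (forall x y, `|D h x y| <= phi x y) ->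
  (forall x, (\sum_(0 <= i <oo) (phi 0 (2 ^+ i *: x) / 2 ^+ i)%:E < +oo)%E) ->
  (forall x y,
     phi (2 ^+ n *: x) (2 ^+ n *: y) / 2 ^+ n @[n --> \oo] --> (0 : R)) ->
  exists G : X -> Y,
    [/\ forall x y, D G x y = 0, forall x, G (- x) = s *: G x,
        forall x, G (2 *: x) = (9 + 7 * s) *: G x &
        forall x, (`|h x - G x|%:E <= \sum_(0 <= i <oo)
          (phi 0 (2 ^+ i *: x) / 3 / (9 + 7 * s) ^+ i.+1)%:E)%E].
Proof.
set c := 9 + 7 * s => c2 h0 hs hD ps pl.
have [c0 c_ge0] : 0 < c /\ 0 <= c by split; lra.
have c_neq0 : c != 0 by rewrite gt_eqF.
have phi0 x y : 0 <= phi x y by exact: le_trans (hD x y).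
have hc x : `|h (2 *: x) - c *: h x| <= phi 0 x / 3.
  have := hD 0 x; rewrite (D0l _ h0 hs) normrZ ger0_norm //; lra.
have ps3 x : (\sum_(0 <= i <oo) (phi 0 (2 ^+ i *: x) / 3 / 2 ^+ i)%:E < +oo)%E.
  under eq_eseriesr do rewrite mulrAC mulrC EFinM.
  rewrite nneseriesZl => [|i _]; last by rewrite lee_fin divr_ge0 ?exprn_ge0.
  by rewrite lte_mul_pinfty.
have [G HG] := hyers_direct_method c2 hc ps3; exists G.
have Gl x : c ^- n *: h (2 ^+ n *: x) @[n --> \oo] --> G x by have [] := HG x.
have lim_inj (u v : Y ^nat) (x y : Y) :
    u n @[n --> \oo] --> x -> v n @[n --> \oo] --> y ->
    (forall n, u n = v n) -> x = y.
  move=> ux vy /funext uv; rewrite uv in ux.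
  exact: (cvg_unique (@norm_hausdorff _ _) ux vy).
have DG x y : D G x y = 0.
  (* [D] is a finite linear combination of values, so it passes to the pointwise limit; on the
     approximants it is at most phi (2^n x) (2^n y) / 2^n, which tends to 0. *)
  pose w n := D (fun x => c ^- n *: h (2 ^+ n *: x)) x y.
  have wD n : w n = c ^- n *: D h (2 ^+ n *: x) (2 ^+ n *: y).
    have e a b : 2 ^+ n *: (a + b) = 2 ^+ n *: a + 2 ^+ n *: b :> X.
      exact: scalerDr.
    have e2 a : 2 ^+ n *: (2 *: a) = 2 *: (2 ^+ n *: a) :> X by lmod R.
    by rewrite /w /D !e !e2 !scalerN; lmod R; rewrite expf_neq0.
  have wl : w n @[n --> \oo] --> D G x y.
    rewrite /w /D.
    by do ![apply: cvgB | apply: cvgD | apply: cvgZl_tmp | exact: Gl].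
  have w0 : w n @[n --> \oo] --> (0 : Y).
    apply: norm_cvg0; apply: (squeeze_cvgr _ (cvg_cst _) (pl x y)).
    apply: nearW => n; rewrite normr_ge0 /= wD normrZ.
    rewrite ger0_norm ?invr_ge0 ?exprn_ge0 //.
    rewrite mulrC; apply: (le_trans (ler_div_exp n c2 (normr_ge0 _))).
    by rewrite ler_wpM2r ?invr_ge0 ?exprn_ge0.
  exact: (cvg_unique (@norm_hausdorff _ _) wl w0).
split => //.
- move=> x; apply: (lim_inj _ _ _ _ (Gl (- x)) (cvgZl_tmp (Gl x))) => n.
  by rewrite scalerN hs; lmod R; rewrite expf_neq0.
(* The n-th approximant at 2x is c times the (n+1)-st at x. *)
- move=> x; have Gx := Gl x; rewrite -cvg_shiftS in Gx.
  apply: (lim_inj _ _ _ _ (Gl (2 *: x)) (cvgZl_tmp Gx)) => n /=.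
  rewrite (_ : 2 ^+ n *: (2 *: x) = 2 ^+ n.+1 *: x); last by rewrite scalerA exprSr.
  by rewrite (exprS c); lmod R; rewrite ?expf_neq0 c_neq0.
- by move=> x; have [] := HG x.
Qed.
End Hyers.

(** * Existence and uniqueness of the quartic and additive approximations *)

Theorem theorem3p5 (R : realType) (X : normedModType R)
    (Y : completeNormedModType R) (psi : X -> X -> R) (f : X -> Y)
    (psi_ge0 : forall x y : X, 0 <= psi x y)
    (psi_sum : forall x : X,
      (\sum_(0 <= i <oo) (psi 0 (2 ^+ i *: x) / 2 ^+ i)%:E < +oo)%E)
    (psi_lim : forall x y : X,
      psi (2 ^+ n *: x) (2 ^+ n *: y) / 2 ^+ n @[n --> \oo] --> (0 : R))
    (f_psi : forall x y : X, `|D f x y| <= psi x y)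
    (f0 : f 0 = 0) :
  exists! QA : (X -> Y) * (X -> Y), let: (Q, A) := QA in
    [/\ quartic Q, additive_fun A, mixed_eq Q, mixed_eq A &
      forall x : X,
        (`|f x - Q x - A x|%:E <=
         (1 / 48)%:E *
         \sum_(0 <= i <oo)
           ((psi 0 (2 ^+ i *: x) + psi 0 (- (2 ^+ i *: x))) / (2 * 16 ^+ i)
            + 12 * (psi 0 (2 ^+ i *: x) + psi 0 (- (2 ^+ i *: x)))
              / 2 ^+ i)%:E)%E].
Proof.
pose p x := psi 0 x + psi 0 (- x).
pose S x := (\sum_(0 <= i <oo) (p (2 ^+ i *: x) / 2 ^+ i)%:E)%E.
pose r x i := p (2 ^+ i *: x) / (2 * 16 ^+ i) + 12 * p (2 ^+ i *: x) / 2 ^+ i.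
have p_ge0 x : 0 <= p x by rewrite addr_ge0.
have pn_ge0 x (n : nat) (k : R) : 0 <= k -> 0 <= p x / k ^+ n.
  by move=> k0; rewrite divr_ge0 ?exprn_ge0.
have r_ge0 x i : 0 <= r x i.
  by rewrite addr_ge0 ?divr_ge0 ?mulr_ge0 ?exprn_ge0.
have Sfin x : (S x < +oo)%E.
  rewrite (_ : S x = \sum_(0 <= i <oo) (psi 0 (2 ^+ i *: x) / 2 ^+ i)%:E
      + \sum_(0 <= i <oo) (psi 0 (2 ^+ i *: - x) / 2 ^+ i)%:E)%E.
    exact: lte_add_pinfty.
  rewrite -nneseriesD => [|i _ _|i _ _]; rewrite ?lee_fin ?divr_ge0 ?exprn_ge0 //.
  by apply: eq_eseriesr => i _; rewrite -EFinD /p scalerN mulrDl.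
(* Symmetrising [psi] gives one control function for both parity parts, as |s| = 1. *)
pose phi x y := 2^-1 * (psi x y + psi (- x) (- y)).
have phi0 x : phi 0 x = 2^-1 * p x by rewrite /phi oppr0.
have phi_sum x : (\sum_(0 <= i <oo) (phi 0 (2 ^+ i *: x) / 2 ^+ i)%:E < +oo)%E.
  under eq_eseriesr do rewrite phi0 -mulrA EFinM.
  rewrite nneseriesZl => [|i _]; last by rewrite lee_fin pn_ge0.
  by rewrite lte_mul_pinfty ?lee_fin ?invr_ge0 //; exact: Sfin.
have phi_lim x y :
    phi (2 ^+ n *: x) (2 ^+ n *: y) / 2 ^+ n @[n --> \oo] --> (0 : R).
  under eq_fun do rewrite /phi -!scalerN -mulrA mulrDl.
  have -> : 0 = 2^-1 * (0 + 0) :> R by rewrite addr0 mulr0.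
  by apply: cvgMl_tmp; apply: cvgD; exact: psi_lim.
have part0 s : parity_part s f 0 = 0.
  by rewrite /parity_part oppr0 f0 scaler0 addr0 scaler0.
have partD s x y : `|s| = 1 -> `|D (parity_part s f) x y| <= phi x y.
  move=> s1; rewrite D_parity_part normrZ ger0_norm ?invr_ge0 //.
  rewrite ler_wpM2l ?invr_ge0 // (le_trans (ler_normD _ _)) // normrZ s1 mul1r.
  exact: lerD.
have [Q [DQ _ Q2 fQ]] : exists Q : X -> Y, [/\ forall x y, D Q x y = 0,
    forall x, Q (- x) = 1 *: Q x, forall x, Q (2 *: x) = (9 + 7 * 1) *: Q x &
    forall x, (`|parity_part 1 f x - Q x|%:E <= \sum_(0 <= i <oo)
      (phi 0 (2 ^+ i *: x) / 3 / (9 + 7 * 1) ^+ i.+1)%:E)%E].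
  apply: stable_part => //; first by lra.
    by move=> x; rewrite /parity_part opprK !scale1r addrC.
  by move=> x y; apply: partD; rewrite normr1.
have [A [DA AN A2 fA]] : exists A : X -> Y, [/\ forall x y, D A x y = 0,
    forall x, A (- x) = (- 1) *: A x,
    forall x, A (2 *: x) = (9 + 7 * - 1) *: A x &
    forall x, (`|parity_part (- 1) f x - A x|%:E <= \sum_(0 <= i <oo)
      (phi 0 (2 ^+ i *: x) / 3 / (9 + 7 * - 1) ^+ i.+1)%:E)%E].
  apply: stable_part => //; first by lra.
    by move=> x; rewrite /parity_part opprK; lmod R.
  by move=> x y; apply: partD; rewrite normrN normr1.
have c16 : 9 + 7 * 1 = 16 :> R by ring.
have c2 : 9 + 7 * - 1 = 2 :> R by ring.
rewrite c16 in Q2 fQ; rewrite c2 in A2 fA.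
have fQA x : (`|f x - Q x - A x|%:E
    <= (1 / 48)%:E * \sum_(0 <= i <oo) (r x i)%:E)%E.
  rewrite -nneseriesZl => [|i _]; last by rewrite lee_fin.
  apply: (@le_trans _ _ (`|parity_part 1 f x - Q x|%:E
                         + `|parity_part (- 1) f x - A x|%:E)%E).
    rewrite -EFinD lee_fin; apply: le_trans (ler_normD _ _).
    rewrite (_ : f x - Q x - A x = parity_part 1 f x - Q x
        + (parity_part (- 1) f x - A x)) //.
    by rewrite /parity_part; lmod R.
  apply: (le_trans (leeD (fQ x) (fA x))).
  have terms_ge0 (c : R) i : 0 <= c -> 0 <= phi 0 (2 ^+ i *: x) / 3 / c ^+ i.+1.
    by move=> c0; rewrite phi0 !divr_ge0 ?mulr_ge0 ?invr_ge0 ?exprn_ge0.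
  rewrite -nneseriesD; try by move=> i _ _; rewrite lee_fin terms_ge0.
  apply: lee_nneseries => [i _ _|i _].
    by rewrite adde_ge0 // lee_fin terms_ge0.
  (* With p taken at 2^i x, the even term p / (6 * 16^(i+1)) is exactly (1/48) p / (2 * 16^i); the
     odd term p / (6 * 2^(i+1)) is (1/48) 4 p / 2^i, below the allowed 12. *)
  rewrite -EFinD -EFinM lee_fin phi0 /r !exprS !invfM.
  have := pn_ge0 (2 ^+ i *: x) i 2 (ler0n _ 2); lra.
have qQ : quartic Q by exact: D_quartic.
have aA : additive_fun A by apply: D_additive => // x; rewrite AN scaleN1r.
exists (Q, A); split.
  by split => //; exact: D_mixed_eq.
move=> [Q' A'] [qQ' aA' _ _ fQA'].
have rS x : ((1 / 48)%:E * \sum_(0 <= i <oo) (r x i)%:E <= S x)%E.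
  rewrite -nneseriesZl => [|i _]; last by rewrite lee_fin.
  apply: lee_nneseries => [i _ _|i _]; first by rewrite mule_ge0 ?lee_fin.
  (* Bounding 1/16^i by 1/2^i leaves the factor (1/2 + 12) / 48 < 1. *)
  rewrite -EFinM lee_fin /r invfM.
  have := pn_ge0 (2 ^+ i *: x) i 2 (ler0n _ 2).
  have le2_16 : 2 <= 16 :> R by lra.
  have := ler_div_exp i le2_16 (p_ge0 (2 ^+ i *: x)); lra.
have SN x : S (- x) = S x.
  by apply: eq_eseriesr => i _; rewrite /p !scalerN opprK addrC.
have diff x : (`|(Q x - Q' x) + (A x - A' x)|%:E <= 2%:E * S x)%E.
  rewrite -[2]/(1 + 1) EFinD ge0_muleDl ?lee_fin // !mul1e.
  apply: (le_trans _ (leeD (le_trans (fQA' x) (rS x)) (le_trans (fQA x) (rS x)))).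
  rewrite -EFinD lee_fin; apply: le_trans (ler_normB _ _).
  rewrite [X in _ <= `|X|](_ : _ = (Q x - Q' x) + (A x - A' x)) //.
  by lmod R.
(* This is [diff] at -x: the quartic difference is even, the additive one odd, and [S] is even. *)
have diffN x : (`|(Q x - Q' x) - (A x - A' x)|%:E <= 2%:E * S x)%E.
  have := diff (- x); rewrite SN (quarticN _ qQ) (quarticN _ qQ')
    (additive_funN _ aA) (additive_funN _ aA').
  by rewrite -opprD.
have half (u v : Y) (b : \bar R) : (`|u + v|%:E <= b)%E -> (`|u - v|%:E <= b)%E ->
    (`|u|%:E <= b)%E.
  case: b => [b| |]; [|by rewrite !leey|by rewrite leeNy_eq].
  rewrite !lee_fin => uv1 uv2; have := ler_normD (u + v) (u - v).
  rewrite (_ : u + v + (u - v) = 2 *: u); last by lmod R.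
  by rewrite normrZ ger0_norm //; lra.
have Q0 x : Q x - Q' x = 0.
  apply: (@scaling_eq0 _ _ _ (fun x => Q x - Q' x) 16 2 p) => //.
  - by lra.
  - by move=> z /=; rewrite (quartic2 _ qQ) (quartic2 _ qQ') scalerBr.
  - by move=> z; exact: half (diff z) (diffN z).
(* Once the quartic difference vanishes, [diff] bounds the additive one directly. *)
have A0 x : A x - A' x = 0.
  apply: (@scaling_eq0 _ _ _ (fun x => A x - A' x) 2 2 p) => //.
  - by move=> z /=; rewrite (additive_fun2 _ aA) (additive_fun2 _ aA') scalerBr.
  - by move=> z; move: (diff z); rewrite Q0 add0r.
by congr (_, _); apply/funext => x; apply/eqP; rewrite -subr_eq0 ?Q0 ?A0.
Qed.
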